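(* $\bigl(\overline{\mathcal C}(\mathbb R^n),\overline h\bigr)$ is a complete metric space.
   Context: $\mathbb R^n$ carries the Euclidean distance $d$. For nonempty $A,B\subseteq\mathbb R^n$, with $d(x,A)=d(A,x)=\inf\{d(x,a):a\in A\}$, the Hausdorff distance is $h(A,B)=\max\{\sup_{a\in A}d(a,B),\ \sup_{b\in B}d(A,b)\}$. An isometry $\psi$ of $\mathbb R^n$ is rigid if $\psi=\sigma\circ\tau$ with $\tau$ a translation and $\sigma$ an orthogonal transformation with $\det\sigma=1$. Write $A\simeq B$ if $B=\psi(A)$ for some rigid isometry $\psi$; this is an equivalence relation and the class of $A$ is $\overline A$. The (absolute) rigid shape difference is $\overline h(A,B)=\inf\{h(\varphi(A),\psi(B)):\varphi,\psi\text{ rigid isometries of }\mathbb R^n\}$; it depends only on the classes and one sets $\overline h(\overline A,\overline B):=\overline h(A,B)$. $\mathcal C(\mathbb R^n)$ is the set of nonempty compact subsets of $\mathbb R^n$, and $\overline{\mathcal C}(\mathbb R^n)=\{\overline C: C\in\mathcal C(\mathbb R^n)\}$. *)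

(* Defs.v *)
From HB Require Import structures.
From mathcomp Require Import all_boot all_order all_algebra.
From mathcomp Require Import all_classical all_reals all_analysis.

Set Implicit Arguments.
Unset Strict Implicit.
Unset Printing Implicit Defensive.

Import Order.TTheory GRing.Theory Num.Theory.
Import numFieldNormedType.Exports.

Local Open Scope classical_set_scope.
Local Open Scope ring_scope.

Section rigid_shapes.
Context {R : realType} {n : nat}.
Implicit Types (x y : 'rV[R]_n) (A B : set 'rV[R]_n).

(* The norm that the library puts on row vectors is the sup norm; it induces
   the same topology, hence the same compact sets, as this distance. *)
Definition euclidean_dist x y : R :=
  Num.sqrt (\sum_(i < n) (x ord0 i - y ord0 i) ^+ 2).

(* The quantities below take values in \bar R because the suprema involved are
   infinite for some unbounded sets. *)
Definition point_dist x A : \bar R :=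
  ereal_inf [set (euclidean_dist x a)%:E | a in A].

Definition hausdorff_dist A B : \bar R :=
  maxe (ereal_sup [set point_dist a B | a in A])
       (ereal_sup [set point_dist b A | b in B]).

Definition translation (v x : 'rV[R]_n) : 'rV[R]_n := x + v.

(* Row vectors: the orthogonal matrix Q acts on the right. *)
Definition rigid (psi : 'rV[R]_n -> 'rV[R]_n) : Prop :=
  exists (Q : 'M[R]_n) (v : 'rV[R]_n),
    [/\ Q *m Q^T = 1%:M, \det Q = 1 & psi = (mulmxr Q) \o (translation v)].

Definition rigid_equiv A B : Prop := exists2 psi, rigid psi & B = psi @` A.

Definition rigid_class A : set (set 'rV[R]_n) := [set B | rigid_equiv A B].

Definition shape_diff A B : \bar R :=
  ereal_inf [set e | exists phi psi, [/\ rigid phi, rigid psi &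
    e = hausdorff_dist (phi @` A) (psi @` B)]].

Definition compact_sets : set (set 'rV[R]_n) :=
  [set C | C !=set0 /\ compact C].

Definition shapes : set (set (set 'rV[R]_n)) :=
  [set rigid_class C | C in compact_sets].

End rigid_shapes.

Arguments compact_sets R n : clear implicits.
Arguments shapes R n : clear implicits.

(* The axiom of completeType, which is only available for pointed types, with
   cvg F spelled out as the existence of a limit. *)
Definition complete_space (T : uniformType) : Prop :=
  forall F : set_system T, ProperFilter F -> cauchy F -> exists l : T, F --> l.

(* Main.v *)
Require Import Defs.
From HB Require Import structures.
From mathcomp Require Import all_boot all_order all_algebra perm.
From mathcomp Require Import ring lra.
From mathcomp Require Import all_classical all_reals all_analysis.

Import Order.TTheory GRing.Theory Num.Theory.
Import numFieldNormedType.Exports.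

Local Open Scope classical_set_scope.
Local Open Scope ring_scope.

Set Implicit Arguments.
Unset Strict Implicit.
Unset Printing Implicit Defensive.

(** The key fact is that the infimum defining the shape difference of two
    compact sets is attained: a rigid map is given by a matrix of the compact
    group SO(n) and by the image of the origin, and the maps that keep one set
    at bounded distance from the other form a compact family
    ([shape_close_limit]). Hence the shape difference of [A] and [B] is at most
    [e] exactly when, for some rigid [psi], every point of [A] is within [e] of
    a point of [psi @` B] and conversely ([shape_diff_leP]).

    This relation, [shape_close e A B], obeys obvious rules: it is symmetric,
    composing rigid maps shows that scales add up, and at scale [0] it says
    that [A] and [B] have the same class. The axioms of a metric on classes,
    and the independence of the representatives, are translations of these
    rules; separation is where attainment matters, since it turns a vanishing
    infimum into an actual rigid map.

    For completeness, choose shapes along a Cauchy filter whose successive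
    distances are at most the powers of one half. Attainment provides rigid
    maps aligning each representative with the previous one; composing them
    gives representatives that form a Cauchy sequence of compact sets for the
    Hausdorff distance itself ([realign]). Such a sequence converges to the
    intersection of suitable closed neighbourhoods of its terms
    ([hausdorff_complete]), and the class of the limit is the limit sought. *)

(** * The Euclidean distance on row vectors *)

Lemma continuous_coord (R : realType) (T : topologicalType) m p
    (f : T -> 'M[R]_(m, p)) i j :
  continuous f -> continuous (fun t => f t i j).
Proof.
move=> fc t; apply: (@continuous_comp _ _ _ f (fun y : 'M[R]_(m, p) => y i j)).
  exact: fc.
exact: coord_continuous.
Qed.

Lemma continuous_mx (R : realType) (T : topologicalType) m p
    (f : T -> 'M[R]_(m, p)) :
  (forall i j, continuous (fun t => f t i j)) -> continuous f.
Proof.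
move=> fc t; apply/cvg_ballP => e e0.
have : \forall s \near t, forall ij : 'I_m * 'I_p,
    ball (f t ij.1 ij.2) e (f s ij.1 ij.2).
  apply: filter_forall => -[i j] /=.
  exact: (fc i j t _ (nbhsx_ballx (f t i j) _ e0)).
by apply: filterS => s fts; split=> // i j; exact: (fts (i, j)).
Qed.

Section euclidean.
Context {R : realType} {n : nat}.
Implicit Types x y z : 'rV[R]_n.

Local Notation dist := (@euclidean_dist R n).

Lemma sum_sqr_ge0 (a : 'I_n -> R) : 0 <= \sum_(i < n) a i ^+ 2.
Proof. by apply: sumr_ge0 => i _; exact: sqr_ge0. Qed.

Lemma euclidean_dist_ge0 x y : 0 <= dist x y.
Proof. exact: sqrtr_ge0. Qed.

Lemma sqr_euclidean_dist x y :
  dist x y ^+ 2 = \sum_(i < n) (x ord0 i - y ord0 i) ^+ 2.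
Proof. by rewrite sqr_sqrtr// sum_sqr_ge0. Qed.

Lemma euclidean_distC x y : dist x y = dist y x.
Proof.
by congr Num.sqrt; apply: eq_bigr => i _; rewrite -sqrrN opprB.
Qed.

Lemma euclidean_distxx x : dist x x = 0.
Proof.
by rewrite /euclidean_dist big1 ?sqrtr0// => i _; rewrite subrr expr0n.
Qed.

Lemma coord_le_euclidean_dist x y i : `|x ord0 i - y ord0 i| <= dist x y.
Proof.
rewrite -sqrtr_sqr ler_wsqrtr// (bigD1 i)//= lerDl.
by apply: sumr_ge0 => j _; exact: sqr_ge0.
Qed.

Lemma euclidean_dist_le0 x y : dist x y <= 0 -> x = y.
Proof.
move=> xy0; apply/rowP => i; apply/eqP; rewrite -subr_eq0 -normr_le0.
exact: le_trans (coord_le_euclidean_dist x y i) xy0.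
Qed.

(** The sum of the squares of [u * a i + v * b i] is nonnegative for all [u]
    and [v]; at [u = t] and [v = - p], where [t] is the sum of the [b i ^+ 2]
    and [p] that of the [a i * b i], it is [t] times the difference of the two
    sides. *)
Lemma cauchy_schwarz_sum (a b : 'I_n -> R) :
  (\sum_(i < n) a i * b i) ^+ 2 <=
  (\sum_(i < n) a i ^+ 2) * (\sum_(i < n) b i ^+ 2).
Proof.
set p := \sum_i a i * b i; set s := \sum_i a i ^+ 2; set t := \sum_i b i ^+ 2.
have expand u v : \sum_(i < n) (u * a i + v * b i) ^+ 2 =
    u ^+ 2 * s + 2 * u * v * p + v ^+ 2 * t.
  rewrite !mulr_sumr -!big_split/=; apply: eq_bigr => i _; ring.
have s0 : 0 <= s := sum_sqr_ge0 a; have t0 : 0 <= t := sum_sqr_ge0 b.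
have := sum_sqr_ge0 (fun i => t * a i + - p * b i); rewrite expand.
have [t_eq0 _|t_gt0 h] := eqVneq t 0; last first.
  have t1 : 0 < t by rewrite lt_neqAle eq_sym t_gt0.
  have : 0 <= t * (s * t - p ^+ 2) by nra.
  by rewrite pmulr_rge0// subr_ge0.
have b0 i : b i = 0.
  apply/eqP; rewrite -sqrf_eq0; apply/eqP.
  by apply: (psumr_eq0P _ t_eq0) => // j _; exact: sqr_ge0.
by rewrite /p big1 ?expr0n ?mulr_ge0// => i _; rewrite b0 mulr0.
Qed.

Lemma euclidean_dist_triangle y x z : dist x z <= dist x y + dist y z.
Proof.
rewrite -(@ler_pXn2r _ 2)// ?nnegrE ?addr_ge0 ?euclidean_dist_ge0//.
rewrite sqrrD !sqr_euclidean_dist.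
set a := fun i => x ord0 i - y ord0 i; set b := fun i => y ord0 i - z ord0 i.
have -> : \sum_i (x ord0 i - z ord0 i) ^+ 2 =
    \sum_i a i ^+ 2 + (\sum_i a i * b i) *+ 2 + \sum_i b i ^+ 2.
  rewrite -mulr_natr mulr_suml -!big_split/=; apply: eq_bigr => i _.
  by rewrite /a /b; ring.
rewrite lerD2r lerD2l lerMn2r/=; apply: le_trans (ler_norm _) _.
by rewrite -sqrtr_sqr -sqrtrM ?sum_sqr_ge0// ler_wsqrtr// cauchy_schwarz_sum.
Qed.

Lemma continuous_euclidean_dist (T : topologicalType) (f g : T -> 'rV[R]_n) :
  continuous f -> continuous g -> continuous (fun t => dist (f t) (g t)).
Proof.
move=> fc gc t; apply: continuous_comp; last exact: sqrt_continuous.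
apply: cvg_big => [|i _]; first exact: add_continuous.
under eq_cvg do rewrite expr2.
have fic : continuous (fun s => f s ord0 i) := continuous_coord fc.
have gic : continuous (fun s => g s ord0 i) := continuous_coord gc.
have fgc := continuousB (fic t) (gic t).
by rewrite expr2; exact: (continuousM fgc fgc).
Qed.

Lemma euclidean_dist_bounded (A : set 'rV[R]_n) x (r : R) :
  (forall a, A a -> dist a x <= r) -> bounded_set A.
Proof.
move=> Ar; exists (r + `|x|); split; first exact: num_real.
move=> M rM a /Ar ar; rewrite -[a](subrK x) /=.
apply: (le_trans (ler_normD _ _)); apply/ltW; apply: le_lt_trans rM.
rewrite lerD2r.
have r0 : 0 <= r := le_trans (euclidean_dist_ge0 _ _) ar.
rewrite [leLHS]/Num.norm/= mx_normrE; apply/bigmax_leP; split => // -[i j] _ /=.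
rewrite !mxE ord1; exact: le_trans (coord_le_euclidean_dist _ _ _) ar.
Qed.

Lemma compact_euclidean_dist_bounded (A : set 'rV[R]_n) x : compact A ->
  exists2 r, 0 <= r & forall a, A a -> dist a x <= r.
Proof.
have [->|/set0P A0 cA] := eqVneq A set0; first by exists 0.
have [|c cA' cmax] := @compact_EVT_max _ R (fun a => dist a x) A A0 cA.
  apply: continuous_subspaceT; apply: continuous_euclidean_dist.
    by move=> ?; exact: cvg_id.
  exact: cst_continuous.
exists (dist c x); first exact: euclidean_dist_ge0.
by move=> a Aa; apply: cmax; exact/mem_set.
Qed.

Lemma compact_euclidean_ball x (r : R) : compact [set y | dist x y <= r].
Proof.
apply: bounded_closed_compact.
  by apply: (@euclidean_dist_bounded _ x r) => y; rewrite euclidean_distC.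
suff /continuous_closedP/(_ _ (@closed_le _ r)) : continuous (dist x) by [].
apply: (@continuous_euclidean_dist _ (fun=> x) id).
  exact: cst_continuous.
by move=> ?; exact: cvg_id.
Qed.

End euclidean.
(** * Two consequences of compactness *)

(** The [K k] generate a proper filter; it has a cluster point in the compact
    set [K 0], which every closed [K k] must contain. *)
Lemma nested_compact_nonempty (T : topologicalType) (K : nat -> set T) :
  (forall k, K k !=set0) -> (forall k, closed (K k)) ->
  (forall k, K k.+1 `<=` K k) -> compact (K 0) -> exists x, forall k, K k x.
Proof.
move=> K0 Kcl Kdecr cK0.
have Kmono i j : (i <= j)%N -> K j `<=` K i.
  apply: (@homo_leq _ K (fun A B => B `<=` A)) => //.
    by move=> A.
  by move=> B A C AB BC; exact: subset_trans BC AB.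
have FF : Filter (filter_from setT K).
  apply: filter_fromT_filter; first by exists 0.
  by move=> i j; exists (maxn i j) => x Kx; split;
    apply: Kmono Kx; rewrite (leq_maxl, leq_maxr).
have PF : ProperFilter (filter_from setT K) by exact: filter_from_proper.
have [|x [_ clx]] := cK0 _ PF; first by exists 0.
by exists x => k; apply: Kcl => B; apply: clx; exists k.
Qed.

(** The projection of a closed set along a compact factor is closed, by the
    tube lemma: if [f u t > e] for every [u] in [K], then the same strict
    inequalities hold on all of [K] for every parameter close to [t]. *)
Lemma closed_exists_compact (R : realType) (U T : topologicalType)
    (K : set U) (f : U -> T -> R) (e : R) :
  compact K -> continuous (fun p : U * T => f p.1 p.2) ->
  closed [set t | exists2 u, K u & f u t <= e].
Proof.
move=> /compact_near_coveringP cK fc; rewrite closedE => t /=.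
apply: contra_notP => /forall2NP nKf.
have : \forall t' \near t, K `<=` (fun u => e < f u t').
  apply: (cK T (nbhs t) (fun t' u => e < f u t') (nbhs_filter t)) => u Ku.
  have [//|/negP] := nKf u; rewrite -ltNge => euf.
  have enbhs : nbhs (f u t) [set r | e < r].
    by apply: open_nbhs_nbhs; split=> //; exact: open_gt.
  exact: (fc (u, t) _ enbhs).
by apply: filterS => t' Kt' [u /Kt'] /=; rewrite ltNge => /negP.
Qed.

(** * The special orthogonal group and rigid maps *)

Section special_orthogonal.
Context {R : realType} {n : nat}.

Definition special_orthogonal : set 'M[R]_n :=
  [set Q | Q *m Q^T = 1%:M /\ \det Q = 1].

Lemma special_orthogonal_tr Q :
  special_orthogonal Q -> special_orthogonal Q^T.
Proof. by case=> /mulmx1C QQ dQ; split; rewrite ?trmxK ?det_tr. Qed.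

Lemma special_orthogonalM Q P : special_orthogonal Q ->
  special_orthogonal P -> special_orthogonal (Q *m P).
Proof.
case=> QQ dQ [PP dP]; split; last by rewrite det_mulmx dQ dP mulr1.
by rewrite trmx_mul mulmxA -(mulmxA Q) PP mulmx1.
Qed.

Lemma special_orthogonal_coord_le1 Q i j :
  special_orthogonal Q -> `|Q i j| <= 1.
Proof.
case=> /matrixP/(_ i i); rewrite !mxE eqxx => QQ _.
rewrite -sqrtr_sqr -(sqrtr1 R) ler_wsqrtr// -[leRHS]QQ (bigD1 j)//= mxE -expr2.
by rewrite lerDl sumr_ge0// => k _; rewrite mxE -expr2 sqr_ge0.
Qed.

(** The group is cut out by polynomial equations, hence closed, and its
    matrices have entries in [-1, 1]. The cube of such matrices is compact as
    the image under [vec_mx] of a cube of row vectors. *)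
Lemma compact_special_orthogonal : compact special_orthogonal.
Proof.
have box : compact [set v : 'rV[R]_(n * n) | forall i, `|v ord0 i| <= 1].
  apply: (@rV_compact R _ (fun=> [set r | `|r| <= 1])) => _.
  have -> : [set r : R | `|r| <= 1] = `[-1, 1]%classic.
    by apply/seteqP; split=> r /=; rewrite in_itv/= ler_norml.
  exact: segment_compact.
have vec_c : continuous (@vec_mx R n n).
  apply: continuous_mx => i j; under eq_fun do rewrite mxE.
  exact: coord_continuous.
have coordc i j := @coord_continuous R n n i j.
apply: (@subclosed_compact _ _ (vec_mx @` [set v : 'rV[R]_(n * n) |
    forall i, `|v ord0 i| <= 1])).
- have -> : special_orthogonal =
      \bigcap_(ij in [set: 'I_n * 'I_n])
        (fun Q : 'M[R]_n => (Q *m Q^T) ij.1 ij.2) @^-1`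
          [set r | r = (1%:M : 'M[R]_n) ij.1 ij.2] `&`
      (fun Q : 'M[R]_n => \det Q) @^-1` [set r | r = 1].
    apply/seteqP; split=> [Q [QQ dQ]|Q [QQ dQ]]; split=> //.
      by move=> [i j] _ /=; rewrite QQ.
    by apply/matrixP => i j; exact: (QQ (i, j)).
  apply: closedI.
    apply: closed_bigI => -[i j] _.
    suff /continuous_closedP/(_ _ (@closed_eq _ ((1%:M : 'M[R]_n) i j))) :
      continuous (fun Q : 'M[R]_n => (Q *m Q^T) i j) by [].
    under eq_fun do rewrite mxE.
    apply: continuous_big => [|k _]; first exact: add_continuous.
    under eq_fun do rewrite mxE.
    by move=> Q; exact: (continuousM (coordc i k Q) (coordc j k Q)).
  suff /continuous_closedP/(_ _ (@closed_eq _ 1)) :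
    continuous (fun Q : 'M[R]_n => \det Q) by [].
  rewrite /determinant; apply: continuous_big => [|s _].
    exact: add_continuous.
  have prodc (t : {perm 'I_n}) :
      continuous (fun Q : 'M[R]_n => \prod_i Q i (t i)).
    by apply: continuous_big => [|i _]; [exact: mul_continuous|exact: coordc].
  move=> Q; exact: (continuousM (@cst_continuous _ _ _ Q) (prodc s Q)).
- by apply: continuous_compact box; exact: continuous_subspaceT.
- move=> Q SQ; exists (mxvec Q); last exact: mxvecK.
  move=> k; case/mxvec_indexP: k => i j; rewrite mxvecE.
  exact: special_orthogonal_coord_le1.
Qed.

End special_orthogonal.

Section rigid_group.
Context {R : realType} {n : nat}.
Implicit Types (psi phi : 'rV[R]_n -> 'rV[R]_n).

Local Notation dist := (@euclidean_dist R n).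

(** Rigid maps with the translation applied last: orthogonal part and image of
    the origin are then read off the pair [p], which makes bounded families of
    rigid maps easy to recognize as subsets of a compact set. *)
Definition rigid_map (p : 'M[R]_n * 'rV[R]_n) (x : 'rV[R]_n) : 'rV[R]_n :=
  x *m p.1 + p.2.

Lemma rigidP psi :
  rigid psi <-> exists2 p, special_orthogonal p.1 & psi = rigid_map p.
Proof.
split=> [[Q [v [QQ dQ ->]]]|[[Q w] [/= QQ dQ] ->]].
  exists (Q, v *m Q) => //; apply/funext => x.
  by rewrite /rigid_map /translation/= mulmxDl.
exists Q, (w *m Q^T); split=> //; apply/funext => x.
by rewrite /rigid_map /translation/= mulmxDl -mulmxA (mulmx1C QQ) mulmx1.
Qed.

Lemma rigid_id : rigid (@id 'rV[R]_n).
Proof.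
apply/rigidP; exists (1%:M, 0).
  by split; rewrite /= ?trmx1 ?mulmx1// det1.
by apply/funext => x; rewrite /rigid_map mulmx1 addr0.
Qed.

Lemma rigid_comp psi phi : rigid psi -> rigid phi -> rigid (psi \o phi).
Proof.
move=> /rigidP[[Q v] SQ ->] /rigidP[[P w] SP ->]; apply/rigidP.
exists (P *m Q, w *m Q + v); first exact: special_orthogonalM.
by apply/funext => x; rewrite /rigid_map/= mulmxDl mulmxA addrA.
Qed.

Lemma rigid_inv psi : rigid psi ->
  exists phi, [/\ rigid phi, cancel psi phi & cancel phi psi].
Proof.
move=> /rigidP[[Q v] SQ ->]; exists (rigid_map (Q^T, - (v *m Q^T))).
have [/= QQ _] := SQ; split.
- apply/rigidP; exists (Q^T, - (v *m Q^T)) => //.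
  exact: special_orthogonal_tr.
- by move=> x; rewrite /rigid_map/= mulmxDl -mulmxA QQ mulmx1 addrK.
- move=> x; rewrite /rigid_map/= mulmxDl -mulmxA mulNmx -[v *m _ *m _]mulmxA.
  by rewrite (mulmx1C QQ) !mulmx1 subrK.
Qed.

Lemma rigid_isometry psi x y : rigid psi -> dist (psi x) (psi y) = dist x y.
Proof.
have distE a b : dist a b = Num.sqrt (((a - b) *m (a - b)^T) ord0 ord0).
  by congr Num.sqrt; rewrite mxE; apply: eq_bigr => i _; rewrite !mxE expr2.
move=> /rigidP[[Q v] [/= QQ _] ->]; rewrite !distE /rigid_map/=.
have -> : x *m Q + v - (y *m Q + v) = (x - y) *m Q.
  by rewrite opprD addrACA subrr addr0 mulmxBl.
by rewrite trmx_mul mulmxA -(mulmxA _ Q) QQ mulmx1.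
Qed.

Lemma continuous_rigid_map (T : topologicalType)
    (p : T -> 'M[R]_n * 'rV[R]_n) (x : T -> 'rV[R]_n) :
  continuous p -> continuous x -> continuous (fun t => rigid_map (p t) (x t)).
Proof.
move=> pc xc; apply: continuous_mx => i j.
under eq_fun do rewrite !mxE.
have p1c : continuous (fun t => (p t).1).
  by move=> t; apply: continuous_comp; [exact: pc|exact: cvg_fst].
have p2c : continuous (fun t => (p t).2).
  by move=> t; apply: continuous_comp; [exact: pc|exact: cvg_snd].
have sumc : continuous (fun t => \sum_k x t i k * (p t).1 k j).
  apply: continuous_big => [|k _]; first exact: add_continuous.
  have xic : continuous (fun t => x t i k) := continuous_coord xc.
  have p1kc : continuous (fun t => (p t).1 k j) := continuous_coord p1c.
  by move=> t; exact: (continuousM (xic t) (p1kc t)).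
have p2jc : continuous (fun t => (p t).2 i j) := continuous_coord p2c.
by move=> t; exact: (continuousD (sumc t) (p2jc t)).
Qed.

Lemma rigid_continuous psi : rigid psi -> continuous psi.
Proof.
move=> /rigidP[p _ ->]; apply: continuous_rigid_map.
  exact: cst_continuous.
by move=> ?; exact: cvg_id.
Qed.

End rigid_group.
(** * Closeness of sets, up to rigid maps *)

Section closeness.
Context {R : realType} {n : nat}.
Implicit Types (x y : 'rV[R]_n) (A B C : set 'rV[R]_n) (e r : R).

Local Notation dist := (@euclidean_dist R n).

(** Asking for a point [b] at distance at most [e], instead of bounding an
    infimum of distances, keeps the calculus of these relations elementary. For
    compact sets nothing is lost, because the infimum is attained. *)
Definition covers e A B := forall a, A a -> exists2 b, B b & dist a b <= e.

Definition hausdorff_close e A B := covers e A B /\ covers e B A.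

(** Moving one of the two sets is enough, since only the relative position of
    [A] and [B] matters. *)
Definition shape_close e A B :=
  exists2 psi, rigid psi & hausdorff_close e A (psi @` B).

Lemma covers_mono e r A B : e <= r -> covers e A B -> covers r A B.
Proof.
by move=> er AB a /AB[b Bb ab]; exists b => //; exact: le_trans er.
Qed.

Lemma covers_trans e r A B C :
  covers e A B -> covers r B C -> covers (e + r) A C.
Proof.
move=> AB BC a /AB[b /BC[c Cc bc] ab]; exists c => //.
by rewrite (le_trans (euclidean_dist_triangle b _ _))// lerD.
Qed.

Lemma covers_rigid e A B psi :
  rigid psi -> covers e A B -> covers e (psi @` A) (psi @` B).
Proof.
move=> rpsi AB _ [a /AB[b Bb ab] <-].
by exists (psi b); [exists b|rewrite rigid_isometry].
Qed.

(** The point of [B] nearest to a given [a] does not depend on [k]. *)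
Lemma covers_limit e A B : compact B ->
  (forall k, covers (e + k.+1%:R^-1) A B) -> covers e A B.
Proof.
move=> cB AB a Aa; have [b0 Bb0 _] := AB 0%N a Aa.
have [||b Bb bmin] := @compact_EVT_min _ R (dist a) B _ cB.
- by exists b0.
- apply: continuous_subspaceT; apply: continuous_euclidean_dist.
    exact: cst_continuous.
  by move=> ?; exact: cvg_id.
exists b; first exact/set_mem.
rewrite leNgt; apply/negP => /ltr_add_invr[k ekb].
have [b' Bb' ab'] := AB k a Aa.
by have := lt_le_trans ekb (bmin _ (mem_set Bb')); rewrite ltNge ab'.
Qed.

Lemma hausdorff_close_refl A : hausdorff_close 0 A A.
Proof. by split=> a Aa; exists a; rewrite ?euclidean_distxx. Qed.

Lemma hausdorff_close_sym e A B :
  hausdorff_close e A B -> hausdorff_close e B A.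
Proof. by case. Qed.

Lemma hausdorff_close_mono e r A B :
  e <= r -> hausdorff_close e A B -> hausdorff_close r A B.
Proof. by move=> er [AB BA]; split; apply: (covers_mono er). Qed.

Lemma hausdorff_close_trans e r A B C : hausdorff_close e A B ->
  hausdorff_close r B C -> hausdorff_close (e + r) A C.
Proof.
move=> [AB BA] [BC CB]; split; first exact: covers_trans AB BC.
by rewrite addrC; exact: covers_trans CB BA.
Qed.

Lemma hausdorff_close_rigid e A B psi : rigid psi ->
  hausdorff_close e A B -> hausdorff_close e (psi @` A) (psi @` B).
Proof. by move=> rpsi [AB BA]; split; exact: covers_rigid. Qed.

Lemma hausdorff_close_limit e A B : compact A -> compact B ->
  (forall k, hausdorff_close (e + k.+1%:R^-1) A B) -> hausdorff_close e A B.
Proof.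
by move=> cA cB AB; split; apply: covers_limit => // k; case: (AB k).
Qed.

Lemma compact_sets_rigid A psi :
  rigid psi -> compact_sets R n A -> compact_sets R n (psi @` A).
Proof.
move=> rpsi [A0 cA]; split; first exact: image_nonempty.
apply: continuous_compact => //; apply: continuous_subspaceT.
exact: rigid_continuous.
Qed.

Lemma hausdorff_dist_leP e A B : compact_sets R n A -> compact_sets R n B ->
  (hausdorff_dist A B <= e%:E)%E <-> hausdorff_close e A B.
Proof.
have half C D : compact_sets R n D ->
    (ereal_sup [set point_dist a D | a in C] <= e%:E)%E <-> covers e C D.
  move=> [D0 cD]; split=> [CD c Cc|CD].
    have cDe : (point_dist c D <= e%:E)%E.
      by apply: le_trans CD; apply: ereal_sup_ubound; exists c.
    have [|d Dd dmin] := @compact_EVT_min _ R (dist c) D D0 cD.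
      apply: continuous_subspaceT; apply: continuous_euclidean_dist.
        exact: cst_continuous.
      by move=> ?; exact: cvg_id.
    exists d; first exact/set_mem.
    rewrite -lee_fin; apply: le_trans cDe; apply: le_ereal_inf_tmp.
    by move=> _ [b Db <-]; rewrite lee_fin dmin//; exact/mem_set.
  apply: ge_ereal_sup => _ [c /CD[d Dd cd] <-].
  apply: (@le_trans _ _ (dist c d)%:E); last by rewrite lee_fin.
  by apply: ereal_inf_lbound; exists d.
move=> cA cB; rewrite /hausdorff_dist ge_max; split.
  by move=> /andP[/half ? /half ?]; split; auto.
by move=> [AB BA]; apply/andP; split; apply/half.
Qed.

Lemma shape_close_refl A : shape_close 0 A A.
Proof.
by exists id; [exact: rigid_id|rewrite image_id; exact: hausdorff_close_refl].
Qed.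

Lemma shape_close_sym e A B : shape_close e A B -> shape_close e B A.
Proof.
move=> [psi rpsi AB]; have [phi [rphi psiK phiK]] := rigid_inv rpsi.
exists phi => //; have := hausdorff_close_rigid rphi AB.
rewrite image_comp (_ : phi \o psi = id) ?image_id.
  exact: hausdorff_close_sym.
by apply/funext => x; exact: psiK.
Qed.

Lemma shape_close_trans e r A B C : shape_close e A B ->
  shape_close r B C -> shape_close (e + r) A C.
Proof.
move=> [psi rpsi AB] [phi rphi BC].
exists (psi \o phi); first exact: rigid_comp.
rewrite -image_comp; apply: hausdorff_close_trans AB _.
exact: hausdorff_close_rigid.
Qed.

(** Closeness of [A] and of the moved set is an intersection, over the points
    of both sets, of conditions asking for a point of the other set: each is
    closed in [p] because it is a projection along a compact set. *)
Lemma closed_hausdorff_close_rigid_map e A B : compact A -> compact B ->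
  closed [set p | hausdorff_close e A (rigid_map p @` B)].
Proof.
move=> cA cB.
have -> : [set p | hausdorff_close e A (rigid_map p @` B)] =
    \bigcap_(a in A) [set p | exists2 b, B b & dist a (rigid_map p b) <= e] `&`
    \bigcap_(b in B) [set p | exists2 a, A a & dist (rigid_map p b) a <= e].
  apply/seteqP; split=> p.
    move=> [AB BA]; split=> [a /AB[_ [b Bb <-] ab]|b Bb]; first by exists b.
    by apply: BA; exists b.
  move=> [AB BA]; split=> [a /AB[b Bb ab]|_ [b Bb <-]]; last exact: BA.
  by exists (rigid_map p b) => //; exists b.
have fstc (S T : topologicalType) : continuous (fun t : S * T => t.1).
  by move=> t; exact: cvg_fst.
have sndc (S T : topologicalType) : continuous (fun t : S * T => t.2).
  by move=> t; exact: cvg_snd.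
apply: closedI; apply: closed_bigI.
  move=> a _.
  apply: (closed_exists_compact (f := fun b p => dist a (rigid_map p b))) => //.
  apply: continuous_euclidean_dist; first exact: cst_continuous.
  by apply: continuous_rigid_map; [exact: sndc|exact: fstc].
move=> b _.
apply: (closed_exists_compact (f := fun a p => dist (rigid_map p b) a)) => //.
apply: continuous_euclidean_dist; last exact: fstc.
by apply: continuous_rigid_map; [exact: sndc|exact: cst_continuous].
Qed.

(** The infimum that defines the shape difference is attained. The rigid maps
    that bring [B] within a bounded distance of [A] have their orthogonal part
    in a compact group and move the origin by a bounded amount, so they are
    parametrized by a compact set; those that bring it within
    [e + k.+1%:R^-1] form a decreasing sequence of closed nonempty subsets,
    and a common element brings it within [e]. *)
Lemma shape_close_limit e A B : compact_sets R n A -> compact_sets R n B ->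
  (forall k, shape_close (e + k.+1%:R^-1) A B) -> shape_close e A B.
Proof.
move=> [A0 cA] [[b0 Bb0] cB] AB.
pose K k := [set p : 'M[R]_n * 'rV[R]_n | special_orthogonal p.1] `&`
  [set p | hausdorff_close (e + k.+1%:R^-1) A (rigid_map p @` B)].
have [r _ Ar] := compact_euclidean_dist_bounded 0 cA.
have SOcl : closed [set p : 'M[R]_n * 'rV[R]_n | special_orthogonal p.1].
  have /continuous_closedP : continuous (fun p : 'M[R]_n * 'rV[R]_n => p.1).
    by move=> p; exact: cvg_fst.
  apply; apply: compact_closed; last exact: compact_special_orthogonal.
  exact: norm_hausdorff.
have Kcl k : closed (K k).
  by apply: closedI => //; exact: closed_hausdorff_close_rigid_map.
have [|k|||p Kp] := @nested_compact_nonempty _ K.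
- move=> k; have [psi /rigidP[p Sp ->] ABk] := AB k.
  by exists p; split.
- exact: Kcl.
- move=> k p [Sp ABp]; split => //; apply: hausdorff_close_mono ABp.
  by rewrite lerD2l lef_pV2 ?posrE// ler_nat.
- (* The last component of [p] is the image of the origin; its norm is
     bounded through the image of [b0], which is close to a point of [A]. *)
  apply: (@subclosed_compact _ _ (special_orthogonal `*`
      [set y : 'rV[R]_n | dist 0 y <= r + (e + 1) + dist b0 0])).
  + exact: Kcl.
  + apply: compact_setX; first exact: compact_special_orthogonal.
    exact: compact_euclidean_ball.
  + move=> p [/= Sp [_ BA]]; split => //=.
    have rp : rigid (rigid_map p) by apply/rigidP; exists p.
    have [|a Aa] := BA (rigid_map p b0); first by exists b0.
    rewrite invr1 => ba.
    have -> : p.2 = rigid_map p 0 by rewrite /rigid_map mul0mx add0r.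
    apply: le_trans (euclidean_dist_triangle (rigid_map p b0) _ _) _.
    apply: lerD; last by rewrite rigid_isometry.
    apply: le_trans (euclidean_dist_triangle a _ _) _.
    by apply: lerD; rewrite euclidean_distC// Ar.
- have rp : rigid (rigid_map p).
    by apply/rigidP; exists p => //; case: (Kp 0%N).
  exists (rigid_map p) => //; apply: hausdorff_close_limit => // [|k].
    by case: (compact_sets_rigid rp (conj (ex_intro _ b0 Bb0) cB)).
  by case: (Kp k).
Qed.

(** Since rigid maps are isometries, the distance between the moved sets
    [phi @` A] and [psi @` B] is that between [A] and the image of [B] under
    the inverse of [phi] after [psi]. *)
Lemma shape_diff_leP e A B : compact_sets R n A -> compact_sets R n B ->
  (shape_diff A B <= e%:E)%E <-> shape_close e A B.
Proof.
move=> cA cB; split=> [ABe|[psi rpsi AB]]; last first.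
  apply: (@le_trans _ _ (hausdorff_dist A (psi @` B))).
    apply: ereal_inf_lbound; exists id, psi; split=> //; first exact: rigid_id.
    by rewrite image_id.
  by apply/hausdorff_dist_leP => //; exact: compact_sets_rigid.
apply: shape_close_limit => // k.
have : (shape_diff A B < (e + k.+1%:R^-1)%:E)%E.
  by apply: le_lt_trans ABe _; rewrite lte_fin ltrDl.
move=> /ereal_inf_lt[_ [phi [psi [rphi rpsi ->]]] /ltW].
move=> /hausdorff_dist_leP - /(_ (compact_sets_rigid rphi cA)).
move=> /(_ (compact_sets_rigid rpsi cB)) AB.
have [phi' [rphi' phiK _]] := rigid_inv rphi.
exists (phi' \o psi); first exact: rigid_comp.
have := hausdorff_close_rigid rphi' AB.
rewrite !image_comp (_ : phi' \o phi = id) ?image_id//.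
by apply/funext => x; exact: phiK.
Qed.

Lemma shape_close0 A B : shape_close 0 A B -> rigid_equiv B A.
Proof.
move=> [psi rpsi [AB BA]]; exists psi => //; apply/seteqP; split.
  by move=> a /AB[b Bb /euclidean_dist_le0 ->].
by move=> b /BA[a Aa /euclidean_dist_le0 ->].
Qed.

Lemma shape_close_bounded A B : compact_sets R n A -> compact_sets R n B ->
  exists e, shape_close e A B.
Proof.
move=> [[a0 Aa0] cA] [[b0 Bb0] cB].
have [r _ Ar] := compact_euclidean_dist_bounded b0 cA.
have [s _ Bs] := compact_euclidean_dist_bounded a0 cB.
exists (Num.max r s), id; rewrite ?image_id; first exact: rigid_id.
split=> [a /Ar ab|b /Bs ba].
  by exists b0; rewrite // le_max ab.
by exists a0; rewrite // le_max ba orbT.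
Qed.

End closeness.
(** * Completeness of the space of compact sets *)

Section half_power.
Context {R : realType}.

Definition half_power k : R := 2^-1 ^+ k.

Lemma half_power_gt0 k : 0 < half_power k.
Proof. by rewrite exprn_gt0// invr_gt0. Qed.

Lemma half_powerS k : half_power k = 2 * half_power k.+1.
Proof. by rewrite /half_power exprS mulrA divff// mul1r. Qed.

Lemma half_power_small (e : R) : 0 < e -> exists k, half_power k < e.
Proof.
move=> /ltr_add_invr[k]; rewrite add0r => ke; exists k; apply: le_lt_trans ke.
rewrite /half_power exprVn lef_pV2 ?posrE ?exprn_gt0// -natrX ler_nat.
exact: ltn_expl.
Qed.

End half_power.

Section hausdorff_completeness.
Context {R : realType} {n : nat}.

Local Notation dist := (@euclidean_dist R n).
Local Notation hp := (@half_power R).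

(** The partial sum of [hp i] for [k <= i < k + j] is the difference in the
    statement. *)
Lemma hausdorff_close_telescope (C : nat -> set 'rV[R]_n) :
  (forall k, hausdorff_close (hp k) (C k) (C k.+1)) ->
  forall k j, hausdorff_close (2 * hp k - 2 * hp (k + j)%N) (C k) (C (k + j)%N).
Proof.
move=> CC k; elim=> [|j IH].
  by rewrite addn0 subrr; exact: hausdorff_close_refl.
rewrite addnS; have := hausdorff_close_trans IH (CC (k + j)%N).
apply: hausdorff_close_mono.
by have := @half_powerS R (k + j)%N; lra.
Qed.

(** The limit is the intersection of the closed neighbourhoods [N k] of [C k]
    of radius [2 * hp k], which is the sum of all the remaining steps; this
    choice makes the [N k] decrease. A point of the limit lies in [N k], so it
    is close to [C k]. Conversely a point [x] of [C k] has points of every later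
    [C (k + j)] within [2 * hp k], so the nested compact sets
    [N (k + j)] cut down to that ball around [x] have a common point, which
    lies in the limit. *)
Lemma hausdorff_complete (C : nat -> set 'rV[R]_n) :
  (forall k, compact_sets R n (C k)) ->
  (forall k, hausdorff_close (hp k) (C k) (C k.+1)) ->
  exists2 D, compact_sets R n D & forall k, hausdorff_close (2 * hp k) (C k) D.
Proof.
move=> Ccpt CC; pose N k := [set x | exists2 c, C k c & dist c x <= 2 * hp k].
have Ncl k : closed (N k).
  have [_ cCk] := Ccpt k.
  apply: (closed_exists_compact (f := dist)) => //.
  apply: continuous_euclidean_dist => u; [exact: cvg_fst|exact: cvg_snd].
have Ndecr k : N k.+1 `<=` N k.
  move=> x [c Cc cx]; have [_ /(_ c Cc)[b Cb cb]] := CC k; exists b => //.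
  apply: le_trans (euclidean_dist_triangle c _ _) _.
  by have := @half_powerS R k; rewrite euclidean_distC in cb; lra.
have Nmono k j : N (k + j)%N `<=` N k.
  elim: j => [|j IH]; first by rewrite addn0.
  by rewrite addnS => x /Ndecr /IH.
have Ncpt k : compact (N k).
  have [[c0 _] cCk] := Ccpt k.
  have [r _ Cr] := compact_euclidean_dist_bounded c0 cCk.
  apply: (subclosed_compact (Ncl k)
    (@compact_euclidean_ball _ _ c0 (r + 2 * hp k))).
  move=> x [c Cc cx]; apply: le_trans (euclidean_dist_triangle c _ _) _.
  by rewrite lerD// euclidean_distC Cr.
have CN k : C k `<=` N k.
  move=> c Cc; exists c => //.
  by rewrite euclidean_distxx mulr_ge0// ltW// half_power_gt0.
have limit k x : C k x -> exists2 y, (forall j, N j y) & dist x y <= 2 * hp k.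
  move=> Cx; pose E j := N (k + j)%N `&` [set y | dist x y <= 2 * hp k].
  have [|j|j y [Ny xy]||y Ey] := @nested_compact_nonempty _ E.
  - move=> j; have [/(_ x Cx)[y Cy xy] _] := hausdorff_close_telescope CC k j.
    exists y; split; first exact: CN.
    apply: le_trans xy _; rewrite gerBl mulr_ge0// ltW//; exact: half_power_gt0.
  - apply: closedI => //; apply: compact_closed; first exact: norm_hausdorff.
    exact: compact_euclidean_ball.
  - by split=> //; apply: Ndecr; rewrite -addnS.
  - apply: compact_closedI; first exact: Ncpt.
    apply: compact_closed; first exact: norm_hausdorff.
    exact: compact_euclidean_ball.
  - exists y; last by case: (Ey 0%N).
    by move=> j; apply: (@Nmono _ k); rewrite addnC; case: (Ey j).
exists [set y | forall j, N j y].
  split.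
    have [[c Cc] _] := Ccpt 0%N; have [y Ny _] := limit 0%N c Cc.
    by exists y.
  apply: (@subclosed_compact _ _ (N 0%N)) => //.
  have -> : [set y | forall j, N j y] = \bigcap_j N j.
    by apply/seteqP; split=> y Ny j; [move=> _|]; exact: Ny.
  exact: closed_bigI.
move=> k; split=> [x /limit[y Ny xy]|y /(_ k)[c Cc cy]]; first by exists y.
by exists c; rewrite // euclidean_distC.
Qed.

End hausdorff_completeness.

(** * The metric space of shapes *)

Section shape_metric.
Context {R : realType} {n : nat}.
Implicit Types A B C D : set 'rV[R]_n.

Lemma shape_close_ge0 (e : R) A B :
  compact_sets R n A -> shape_close e A B -> 0 <= e.
Proof.
move=> [[a Aa] _] [psi _ [/(_ a Aa)[b _ ab] _]].
exact: le_trans (euclidean_dist_ge0 _ _) ab.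
Qed.

Lemma fine_shape_diffK A B : compact_sets R n A -> compact_sets R n B ->
  (fine (shape_diff A B))%:E = shape_diff A B.
Proof.
move=> cA cB; apply: fineK; rewrite fin_numE; apply/andP; split.
  apply/eqP => ABoo; have := @shape_diff_leP _ _ (-1) _ _ cA cB.
  rewrite ABoo leNye => -[/(_ isT)/(shape_close_ge0 cA)].
  by rewrite lerNr oppr0 ler10.
have [e /(shape_diff_leP e cA cB)] := shape_close_bounded cA cB.
by apply: contraTneq => ->.
Qed.

Lemma fine_shape_diff_leP (e : R) A B :
  compact_sets R n A -> compact_sets R n B ->
  fine (shape_diff A B) <= e <-> shape_close e A B.
Proof.
by move=> cA cB; rewrite -lee_fin fine_shape_diffK//; exact: shape_diff_leP.
Qed.

(** Equality of classes becomes closeness at scale [0], which composes with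
    closeness at any other scale: this is how independence of the
    representatives is obtained. *)
Lemma rigid_class_eq A B :
  rigid_class A = rigid_class B <-> shape_close 0 A B.
Proof.
have sub C D : rigid_equiv C D -> rigid_class D `<=` rigid_class C.
  move=> [psi rpsi ->] E [phi rphi ->]; exists (phi \o psi).
    exact: rigid_comp.
  by rewrite image_comp.
split=> [AB|AB].
  have [psi rpsi ->] : rigid_class A B.
    by rewrite AB; exists id; [exact: rigid_id|rewrite image_id].
  by apply: shape_close_sym; exists psi => //; exact: hausdorff_close_refl.
apply/seteqP; split; apply: sub; apply: shape_close0 => //.
exact: shape_close_sym.
Qed.

(** A separate name, to carry the metric structure without attaching it to
    the generic construction of a type from a set. *)
Definition shape_space := set_type (shapes R n).

Definition shape_repr (X : shape_space) : set 'rV[R]_n :=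
  sval (cid2 (set_mem (valP X))).

Lemma shape_repr_compact X : compact_sets R n (shape_repr X).
Proof. by rewrite /shape_repr; case: cid2. Qed.

Lemma rigid_class_repr X : rigid_class (shape_repr X) = val X.
Proof. by rewrite /shape_repr; case: cid2. Qed.

Definition shape_dist (X Y : shape_space) : R :=
  fine (shape_diff (shape_repr X) (shape_repr Y)).

Lemma shape_dist_leP (e : R) (X Y : shape_space) C D :
  compact_sets R n C -> compact_sets R n D ->
  val X = rigid_class C -> val Y = rigid_class D ->
  shape_dist X Y <= e <-> shape_close e C D.
Proof.
rewrite -!rigid_class_repr => cC cD /rigid_class_eq XC /rigid_class_eq YD.
rewrite /shape_dist fine_shape_diff_leP; [|exact: shape_repr_compact..].
split=> h.
  rewrite -[e]add0r -[0 + e]addr0.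
  exact: shape_close_trans (shape_close_trans (shape_close_sym XC) h) YD.
rewrite -[e]add0r -[0 + e]addr0.
exact: shape_close_trans (shape_close_trans XC h) (shape_close_sym YD).
Qed.

Lemma shape_distE (X Y : shape_space) C D :
  compact_sets R n C -> compact_sets R n D ->
  val X = rigid_class C -> val Y = rigid_class D ->
  (shape_dist X Y)%:E = shape_diff C D.
Proof.
move=> cC cD XC YD; rewrite -fine_shape_diffK//; congr _%:E.
apply/eqP; rewrite eq_le; apply/andP; split.
  by apply/(shape_dist_leP _ cC cD XC YD)/fine_shape_diff_leP.
by apply/fine_shape_diff_leP => //; apply/(shape_dist_leP _ cC cD XC YD).
Qed.

Lemma shape_dist_close (e : R) X Y :
  shape_dist X Y <= e <-> shape_close e (shape_repr X) (shape_repr Y).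
Proof. by apply: fine_shape_diff_leP; exact: shape_repr_compact. Qed.

Lemma shape_distxx X : shape_dist X X = 0.
Proof.
apply/eqP; rewrite eq_le; apply/andP; split.
  by apply/shape_dist_close; exact: shape_close_refl.
apply: (shape_close_ge0 (shape_repr_compact X)).
exact/shape_dist_close/lexx.
Qed.

Lemma shape_dist_positivity X Y : shape_dist X Y = 0 -> X = Y.
Proof.
move=> XY0; apply: val_inj; rewrite -!rigid_class_repr.
by apply/rigid_class_eq/shape_dist_close; rewrite XY0.
Qed.

Lemma shape_distC X Y : shape_dist X Y = shape_dist Y X.
Proof.
by apply/eqP; rewrite eq_le; apply/andP; split;
  apply/shape_dist_close/shape_close_sym/shape_dist_close.
Qed.

Lemma shape_dist_triangle Y X Z :
  shape_dist X Z <= shape_dist X Y + shape_dist Y Z.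
Proof.
by apply/shape_dist_close; apply: (@shape_close_trans _ _ _ _ _ (shape_repr Y));
  apply/shape_dist_close.
Qed.

HB.instance Definition _ := Choice.on shape_space.
HB.instance Definition _ := @isMetric.Build R shape_space shape_dist
  shape_distxx shape_dist_positivity shape_distC shape_dist_triangle.

(** Composing the rigid maps that align each set with its predecessor turns
    consecutive closeness of shapes into consecutive closeness of sets. *)
Lemma realign (C : nat -> set 'rV[R]_n) (e : nat -> R) :
  (forall k, shape_close (e k) (C k) (C k.+1)) ->
  exists phi : nat -> 'rV[R]_n -> 'rV[R]_n, (forall k, rigid (phi k)) /\
    forall k, hausdorff_close (e k) (phi k @` C k) (phi k.+1 @` C k.+1).
Proof.
move=> CC; pose psi k := sval (cid2 (CC k)).
have rpsi k : rigid (psi k) by rewrite /psi; case: cid2.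
have psiC k : hausdorff_close (e k) (C k) (psi k @` C k.+1).
  by rewrite /psi; case: cid2.
pose phi := fix phi k := if k is j.+1 then phi j \o psi j else id.
have rphi k : rigid (phi k).
  by elim: k => [|k IH]; [exact: rigid_id|exact: rigid_comp].
exists phi; split=> // k; rewrite /= -image_comp.
exact: hausdorff_close_rigid.
Qed.

(** Any two balls that belong to the Cauchy filter meet; with the radii
    [half_power k.+1] their centres form a sequence of shapes with summable
    steps. Realigned representatives of these shapes converge to a compact
    set, whose class is the limit of the filter. *)
Lemma shape_space_complete : complete_space shape_space.
Proof.
move=> F FF /cauchyP Fc.
have /choice[X FX] k : exists x : shape_space, F (ball x (half_power k.+1)).
  by apply: Fc; exact: half_power_gt0.
have XX k : shape_close (half_power k) (shape_repr (X k)) (shape_repr (X k.+1)).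
  apply/shape_dist_close.
  have [Y []] := filter_ex (filterI (FX k) (FX k.+1)).
  rewrite !ballEmdist/= => XY XY'.
  apply: le_trans (shape_dist_triangle Y _ _) _; rewrite (shape_distC Y).
  have := @half_power_gt0 R k.+2; have := @half_powerS R k.
  by have := @half_powerS R k.+1; move: XY XY'; rewrite /mdist/=; lra.
have [phi [rphi CC]] := realign XX.
have [|D cD CD] := hausdorff_complete _ CC.
  by move=> k; apply: compact_sets_rigid => //; exact: shape_repr_compact.
have DS : rigid_class D \in shapes R n by apply/mem_set; exists D.
pose L : shape_space := exist _ (rigid_class D) DS.
have XL k : shape_dist (X k) L <= 2 * half_power k.
  apply/(@shape_dist_leP _ _ _ (shape_repr (X k)) D) => //.
  - exact: shape_repr_compact.
  - by rewrite rigid_class_repr.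
  apply: shape_close_sym; exists (phi k) => //.
  exact: hausdorff_close_sym.
exists L; apply/cvg_ballP => e e0.
have [k ke] : exists k, half_power k < e / 3 by apply: half_power_small; lra.
apply: filterS (FX k) => Y; rewrite !ballEmdist/= /mdist/= => XY.
apply: le_lt_trans (shape_dist_triangle (X k) _ _) _; rewrite shape_distC.
have := @half_power_gt0 R k.+1; have := @half_powerS R k.
by move: (XL k) XY ke; lra.
Qed.

End shape_metric.

Theorem theorem2p5 (R : realType) (n : nat) :
  exists m : Metric.axioms_ R (set_type (shapes R n)),
    let M : metricType R := Metric.Pack m in
    (forall (X Y : M) (C D : set 'rV[R]_n),
       compact_sets R n C -> compact_sets R n D ->
       set_val X = rigid_class C -> set_val Y = rigid_class D ->
       (mdist X Y)%:E = shape_diff C D)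
    /\ complete_space M.
Proof.
exists (Metric.class (@shape_space R n : metricType R)); split.
  exact: shape_distE.
exact: shape_space_complete.
Qed.
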